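(* There is a constant $C$ such that for every mean-zero divergence-free vector field $\mathbf{u}$ on $\mathbb{T}^3=(\mathbb{R}/2\pi\mathbb{Z})^3$ with vorticity $\omega=\nabla\times\mathbf{u}$ and every $s\in\mathbb{R}$, \[ \|\mathbf{u}\|_{H^{s+1}}\le C\,\|\omega\|_{H^s}. \]
   Context: $\|f\|_{H^s}^2=\sum_{\xi\in\mathbb{Z}^3}\langle\xi\rangle^{2s}|\hat f(\xi)|^2$ with $\langle\xi\rangle=(1+|\xi|^2)^{1/2}$; the inequality is understood for fields with $\omega\in H^s$. *)

(* Defs.v *)
From HB Require Import structures.
From mathcomp Require Import all_boot all_order all_algebra.
From mathcomp Require Import all_classical all_reals all_analysis.
From mathcomp Require Import complex.

Set Implicit Arguments.
Unset Strict Implicit.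
Unset Printing Implicit Defensive.

Import Order.TTheory GRing.Theory Num.Theory.
Import numFieldNormedType.Exports.

Local Open Scope classical_set_scope.
Local Open Scope ring_scope.
Local Open Scope complex_scope.

(* The torus (R/2piZ)^3 is handled through 2piZ^3-periodic objects on R^3.
   Since the Sobolev index ranges over all of R, fields are periodic
   distributions, i.e. continuous linear functionals on the smooth functions
   on the torus; a function f is identified with the functional sending phi to
   the integral of f * phi over a period cell.  Test functions are real-valued
   and distributions complex-valued, so that both real and complex fields are
   covered (real ones being those with real values on all test functions). *)

Section TestFunctions.
Variable R : realType.
Implicit Types (f phi psi : 'rV[R]_3 -> R) (j : 'I_3) (x : 'rV[R]_3).

Definition pd j f : 'rV[R]_3 -> R := 'D_(delta_mx 0 j) f.

Definition iter_pd (js : seq 'I_3) f : 'rV[R]_3 -> R :=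
  foldl (fun g j => pd j g) f js.

Definition smooth f : Prop :=
  forall js : seq 'I_3,
    continuous (iter_pd js f) /\
    forall j x, derivable (iter_pd js f) x (delta_mx 0 j : 'rV[R]_3).

Definition periodic f : Prop :=
  forall j x, f (x + (2 * pi) *: delta_mx 0 j) = f x.

Definition test_function f : Prop := smooth f /\ periodic f.

End TestFunctions.

Section Distributions.
Variable R : realType.

(* Only the values on test functions are meaningful. *)
Definition functional := ('rV[R]_3 -> R) -> R[i].

Implicit Types (T : functional) (u w : 'I_3 -> functional).

Definition linear_on_test T : Prop :=
  forall (a : R) (phi psi : 'rV[R]_3 -> R),
    test_function phi -> test_function psi ->
    T (fun x => a * phi x + psi x) = a%:C * T phi + T psi.

(* |T phi| <= C * ||phi||_{C^N}; M stands for any upper bound of the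
   C^N norm. *)
Definition continuous_on_test T : Prop :=
  exists (N : nat) (C : R), forall (phi : 'rV[R]_3 -> R) (M : R),
    test_function phi ->
    (forall (js : seq 'I_3) (x : 'rV[R]_3),
       (size js <= N)%N -> `|iter_pd js phi x| <= M) ->
    Normc.normc (T phi) <= C * M.

Definition distribution T : Prop := linear_on_test T /\ continuous_on_test T.

Definition vector_field u : Prop := forall i : 'I_3, distribution (u i).

Definition dpd (j : 'I_3) T : functional := fun phi => - T (pd j phi).

Definition divergence u : functional :=
  fun phi => \sum_(j < 3) dpd j (u j) phi.

(* Indices are taken modulo 3, by addition in 'I_3. *)
Definition curl u : 'I_3 -> functional :=
  fun i phi => dpd (i + 1) (u (i + 2)) phi - dpd (i + 2) (u (i + 1)) phi.

Definition divergence_free u : Prop :=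
  forall phi : 'rV[R]_3 -> R, test_function phi -> divergence u phi = 0.

Definition mean T : R[i] := (((2 * pi) ^- 3)%:C) * T (fun=> 1).

Definition mean_zero u : Prop := forall i : 'I_3, mean (u i) = 0.

End Distributions.

Section Sobolev.
Variable R : realType.
Implicit Types (xi : 'rV[int]_3) (x : 'rV[R]_3) (T : functional R).

Definition dotp xi x : R := \sum_(j < 3) (xi 0 j)%:~R * x 0 j.

(* (2 pi)^-3 T(e^{-i xi.x}), with T extended complex-linearly. *)
Definition fourier T xi : R[i] :=
  ((2 * pi) ^- 3)%:C *
  (T (fun x => cos (dotp xi x)) - 'i%C * T (fun x => sin (dotp xi x))).

Definition bracket xi : R :=
  Num.sqrt (1 + \sum_(j < 3) ((xi 0 j)%:~R : R) ^+ 2).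

Definition Hnorm (s : R) (w : 'I_3 -> functional R) : \bar R :=
  sqrte (\esum_(xi in [set: 'rV[int]_3])
    ((bracket xi `^ (2 * s)) *
      \sum_(i < 3) Normc.normc (fourier (w i) xi) ^+ 2)%:E).

End Sobolev.

(* Main.v *)
(* Everything is compared mode by mode.  On the mode xi, the Fourier coefficient
   of the curl is i xi x u^(xi), and incompressibility says xi . u^(xi) = 0, so
   Lagrange's identity gives |w^(xi)|^2 = |xi|^2 |u^(xi)|^2.  The mode xi = 0
   vanishes by the mean-zero hypothesis, and for xi <> 0 integrality gives
   |xi| >= 1, hence 1 + |xi|^2 <= 2 |xi|^2; the constant sqrt 2 works. *)
Require Import Defs.
From mathcomp Require Import all_boot all_order all_algebra.
From mathcomp Require Import all_classical all_reals all_analysis.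
From mathcomp Require Import complex ring lra.

Set Implicit Arguments.
Unset Strict Implicit.
Unset Printing Implicit Defensive.

Import Order.TTheory GRing.Theory Num.Theory.
Import numFieldNormedType.Exports.

Local Open Scope classical_set_scope.
Local Open Scope ring_scope.
Local Open Scope complex_scope.

(** * Trigonometric test functions and Fourier coefficients of derivatives *)

Section Waves.
Variable R : realType.
Implicit Types (xi : 'rV[int]_3) (x : 'rV[R]_3) (T S : functional R).

(** Real stand-in for the exponentials of frequency [xi], as test functions are real-valued; for
    fixed [xi] the family is stable under all partial derivatives. *)
Definition wave (a b : R) xi x : R := a * cos (dotp xi x) + b * sin (dotp xi x).

Lemma cos_dotpE xi : (fun x => cos (dotp xi x)) = wave 1 0 xi :> (_ -> R).
Proof. by apply/funext => x; rewrite /wave mul1r mul0r addr0. Qed.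

Lemma sin_dotpE xi : (fun x => sin (dotp xi x)) = wave 0 1 xi :> (_ -> R).
Proof. by apply/funext => x; rewrite /wave mul1r mul0r add0r. Qed.

Lemma dotpD_delta xi x (h : R) j :
  dotp xi (x + h *: delta_mx 0 j) = dotp xi x + h * (xi 0 j)%:~R.
Proof.
rewrite /dotp (eq_bigr (fun i => (xi 0 i)%:~R * x 0 i +
    (if i == j then h * (xi 0 j)%:~R else 0))) => [|i _].
  by rewrite big_split /= -big_mkcond big_pred1_eq.
rewrite !mxE eqxx /= mulrDr; congr (_ + _).
by case: eqVneq => [->|_] /=; rewrite ?mulr1 ?mulr0// mulrC.
Qed.

Lemma dotp_continuous xi : continuous (dotp xi : 'rV[R]_3 -> R).
Proof.
rewrite /dotp; apply: (@continuous_big _ _ +%R 0) => [|j _ x].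
  by move=> z; apply: cvgD; [exact: cvg_fst|exact: cvg_snd].
by apply: continuousM; [exact: cst_continuous|exact: coord_continuous].
Qed.

Lemma is_derive_wave a b xi x j :
  is_derive x (delta_mx 0 j : 'rV[R]_3) (wave a b xi)
    (wave ((xi 0 j)%:~R * b) (- ((xi 0 j)%:~R * a)) xi x).
Proof.
pose k : R := (xi 0 j)%:~R; pose d := dotp xi x.
(* Along the line through [x] in direction [j] the phase is affine with slope [k], so one-variable
   calculus applies. *)
have D : is_derive (0 : R) (1 : R)
    (fun h : R => a * cos (d + h * k) + b * sin (d + h * k))
    (wave (k * b) (- (k * a)) xi x).
  apply: is_derive_eq.
  rewrite mul0r addr0 /wave -/d /GRing.scale /=; ring.
have E : (fun h : R => wave a b xi (h *: (delta_mx 0 j : 'rV[R]_3) + x)) =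
    (fun h : R => a * cos (d + h * k) + b * sin (d + h * k)).
  by apply/funext => h; rewrite /wave [_ *: _ + x]addrC dotpD_delta.
apply: DeriveDef.
  by apply/derivable1P; rewrite E; apply: ex_derive.
rewrite -(@derive_val _ _ _ _ _ _ _ D) -E /derive; congr (lim (_ @ 0^')).
apply/funext => h /=; congr (_ *: (wave _ _ _ _ - wave _ _ _ _)).
- by rewrite addr0 [_%:A]mulr1.
- by rewrite scale0r add0r.
Qed.

Lemma pd_wave a b xi j :
  pd j (wave a b xi) = wave ((xi 0 j)%:~R * b) (- ((xi 0 j)%:~R * a)) xi.
Proof.
by apply/funext => x; exact: (@derive_val _ _ _ _ _ _ _ (is_derive_wave _ _ _ _ _)).
Qed.

Lemma wave_continuous a b xi : continuous (wave a b xi).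
Proof.
move=> x; pose f (t : R) := a * cos t + b * sin t.
apply: (@continuous_comp _ _ _ (dotp xi) f x); first exact: dotp_continuous.
by apply/differentiable_continuous/derivable1_diffP.
Qed.

Lemma iter_pd_wave a b xi js : exists a' b', iter_pd js (wave a b xi) = wave a' b' xi.
Proof.
elim: js a b => [|j js IH] a b; first by exists a, b.
by rewrite /iter_pd /= pd_wave; exact: IH.
Qed.

Lemma cosDz (t : R) (z : int) : cos (t + 2 * pi * z%:~R) = cos t.
Proof.
have P : forall n (t : R), cos (t + 2 * pi * n%:R) = cos t.
  move=> n; elim: n => [|n IH] r; first by rewrite mulr0 addr0.
  rewrite -[n.+1%:R]natr1 mulrDr mulr1 addrA.
  by rewrite [X in _ + X]mulr_natl cosD2pi IH.
case: z => n; first exact: P.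
(* A negative shift is undone by adding the same number of periods. *)
by rewrite NegzE mulrNz mulrN -[LHS](P n.+1) subrK.
Qed.

Lemma sinDz (t : R) (z : int) : sin (t + 2 * pi * z%:~R) = sin t.
Proof. by rewrite -!cosBpihalf addrAC cosDz. Qed.

Lemma wave_test a b xi : test_function (wave a b xi).
Proof.
split=> [js|j x]; last by rewrite /wave dotpD_delta cosDz sinDz.
have [a' [b' ->]] := iter_pd_wave a b xi js.
split; first exact: wave_continuous.
by move=> j x; apply: (@ex_derive _ _ _ _ _ _ _ (is_derive_wave _ _ _ _ _)).
Qed.

Lemma linear_wave T a b xi : linear_on_test T ->
  T (wave a b xi) = a%:C * T (wave 1 0 xi) + b%:C * T (wave 0 1 xi).
Proof.
move=> linT.
(* [linear_on_test] always carries a second summand, so a pure multiple is reached only once [T] is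
   known to kill the zero function; the scalar -1 gives this. *)
have T0 : T (wave 0 0 xi) = 0.
  have := linT (-1) _ _ (wave_test 0 0 xi) (wave_test 0 0 xi).
  rewrite rmorphN1 mulN1r addNr => <-; congr T.
  by apply/funext => x; rewrite mulN1r addNr /wave !mul0r addr0.
have := linT b _ _ (wave_test 0 1 xi) (wave_test 0 0 xi).
rewrite T0 addr0 => Tb.
have := linT a _ _ (wave_test 1 0 xi) (wave_test 0 b xi).
have -> : wave 0 b xi = (fun x => b * wave 0 1 xi x + wave 0 0 xi x).
  by apply/funext => x; rewrite /wave; ring.
rewrite Tb => <-; congr T.
by apply/funext => x; rewrite /wave; ring.
Qed.

Lemma fourierE T xi : fourier T xi =
  ((2 * pi) ^- 3)%:C * (T (wave 1 0 xi) - 'i%C * T (wave 0 1 xi)).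
Proof. by rewrite /fourier cos_dotpE sin_dotpE. Qed.

Lemma fourierB T S xi :
  fourier (fun phi => T phi - S phi) xi = fourier T xi - fourier S xi.
Proof.
by rewrite /fourier -!mulrBr; congr (_ * _); rewrite mulrBr opprD addrACA -opprD.
Qed.

(** Differentiation swaps cosine and sine up to sign and a factor k; with the minus sign of [dpd],
    this is multiplication by ik. *)
Lemma fourier_dpd T xi j : linear_on_test T ->
  fourier (dpd j T) xi = 'i%C * ((xi 0 j)%:~R : R)%:C * fourier T xi.
Proof.
move=> linT; rewrite !fourierE /dpd !pd_wave.
rewrite linear_wave // [T (wave (_ * 1) _ _)]linear_wave //.
move: (T (wave 1 0 xi)) (T (wave 0 1 xi)) => [p q] [p' q'].
set k := (xi 0 j)%:~R; move: (_ ^- 3) => c.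
by rewrite !(mulr0, mulr1, oppr0); simpc; congr Complex; ring.
Qed.

End Waves.

(** * Algebra of the cross product on one mode *)

Section Cross.
Variable R : realType.

Lemma sqr_normcE (z : R[i]) :
  Normc.normc z ^+ 2 = complex.Re z ^+ 2 + complex.Im z ^+ 2.
Proof. by case: z => p q /=; rewrite sqr_sqrtr // addr_ge0 ?sqr_ge0. Qed.

Lemma sum_ord3 (V : nmodType) (F : 'I_3 -> V) :
  \sum_(i < 3) F i = F 0 + F 1 + F 2.
Proof.
rewrite !big_ord_recl big_ord0 addr0 addrA.
by congr (F _ + F _ + F _); apply/val_inj.
Qed.

(* Lagrange's identity $|x \times a|^2 = |x|^2 |a|^2 - |x \cdot a|^2$. *)
Lemma sum_sqr_normc_cross (x : 'I_3 -> R) (a : 'I_3 -> R[i]) :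
  \sum_(j < 3) (x j)%:C * a j = 0 ->
  \sum_(i < 3) Normc.normc ('i%C * (x (i + 1))%:C * a (i + 2) -
                            'i%C * (x (i + 2))%:C * a (i + 1)) ^+ 2 =
  (\sum_(j < 3) x j ^+ 2) * \sum_(j < 3) Normc.normc (a j) ^+ 2.
Proof.
rewrite !sum_ord3 !sqr_normcE.
have -> : 0 + 1 = 1 :> 'I_3 by apply/val_inj.
have -> : 0 + 2 = 2 :> 'I_3 by apply/val_inj.
have -> : 1 + 1 = 2 :> 'I_3 by apply/val_inj.
have -> : 1 + 2 = 0 :> 'I_3 by apply/val_inj.
have -> : 2 + 1 = 0 :> 'I_3 by apply/val_inj.
have -> : 2 + 2 = 1 :> 'I_3 by apply/val_inj.
case: (a 0) (a 1) (a 2) => [p0 q0] [p1 q1] [p2 q2].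
move: (x 0) (x 1) (x 2) => x0 x1 x2.
simpc => /eqP; rewrite eq_complex /= => /andP[/eqP re0 /eqP im0].
set rhs := RHS.
(* As [x] is real, Lagrange's identity holds for the real and imaginary parts of [a] separately;
   both dot products vanish. *)
transitivity (rhs - (x0 * p0 + x1 * p1 + x2 * p2) ^+ 2
                  - (x0 * q0 + x1 * q1 + x2 * q2) ^+ 2).
  by rewrite /rhs; ring.
by rewrite re0 im0 expr0n !subr0.
Qed.

End Cross.

(** * Comparison of velocity and vorticity mode by mode *)

Section Bound.
Variable R : realType.
Implicit Types (xi : 'rV[int]_3) (u : 'I_3 -> functional R).

Definition sqr_freq xi : R := \sum_(j < 3) ((xi 0 j)%:~R : R) ^+ 2.

Lemma sqr_freq_ge1 xi : xi != 0 -> 1 <= sqr_freq xi.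
Proof.
move=> xi0; have [j xj] : exists j, xi 0 j != 0.
  by case/rV0Pn: xi0 => j; exists j.
rewrite /sqr_freq (bigD1 j) //= ler_wpDr //.
  by apply: sumr_ge0 => i _; exact: sqr_ge0.
(* The square is pulled back to the integers, where positive means at least 1. *)
by rewrite -rmorphXn /= (ler_int _ 1) -gtz0_ge1 exprn_even_gt0 // orbT.
Qed.

(** One more derivative multiplies the squared weight by $\langle\xi\rangle^2 = 1+|\xi|^2$. *)
Lemma bracket_powRD1 (s : R) xi :
  bracket R xi `^ (2 * (s + 1)) = bracket R xi `^ (2 * s) * (1 + sqr_freq xi).
Proof.
have q0 : 0 <= sqr_freq xi by apply: sumr_ge0 => j _; exact: sqr_ge0.
have b0 : 0 < bracket R xi by rewrite sqrtr_gt0 ltr_wpDr.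
rewrite mulrDr mulr1 powRD; last by rewrite (gt_eqF b0) implybT.
by rewrite powR_mulrn ?ltW // sqr_sqrtr // addr_ge0.
Qed.

Definition energy u xi : R := \sum_(i < 3) Normc.normc (fourier (u i) xi) ^+ 2.

Lemma energy_ge0 u xi : 0 <= energy u xi.
Proof. by apply: sumr_ge0 => i _; exact: sqr_ge0. Qed.

Lemma fourier_divergence_free u xi : vector_field u -> divergence_free u ->
  \sum_(j < 3) ((xi 0 j)%:~R : R)%:C * fourier (u j) xi = 0.
Proof.
move=> vu divu.
have divC : divergence u (wave 1 0 xi) = 0 by apply: divu; exact: wave_test.
have divS : divergence u (wave 0 1 xi) = 0 by apply: divu; exact: wave_test.
(* Both sides are the Fourier coefficient of the divergence, which vanishes on both waves; then $i$
   is cancelled. *)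
have /eqP : 'i%C * \sum_(j < 3) ((xi 0 j)%:~R : R)%:C * fourier (u j) xi =
    ((2 * pi) ^- 3)%:C *
      (divergence u (wave 1 0 xi) - 'i%C * divergence u (wave 0 1 xi)).
  rewrite /divergence !mulr_sumr -sumrB mulr_sumr; apply: eq_bigr => j _.
  by rewrite mulrA -fourier_dpd ?fourierE //; case: (vu j).
rewrite divC divS mulr0 subr0 mulr0 mulf_eq0 => /orP[|/eqP //].
by rewrite eq_complex /= oner_eq0 andbF.
Qed.

Lemma energy_curl u xi : vector_field u -> divergence_free u ->
  energy (curl u) xi = sqr_freq xi * energy u xi.
Proof.
move=> vu divu.
rewrite -(sum_sqr_normc_cross (fourier_divergence_free xi vu divu)).
apply: eq_bigr => i _; congr (Normc.normc _ ^+ 2).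
have lin j : linear_on_test (u j) by case: (vu j).
by rewrite -!fourier_dpd // -fourierB.
Qed.

Lemma fourier0_mean_zero u i : vector_field u -> mean_zero u -> fourier (u i) 0 = 0.
Proof.
move=> vu mu; have lin : linear_on_test (u i) by case: (vu i).
have dot0 (x : 'rV[R]_3) : dotp 0 x = 0.
  by rewrite /dotp big1 // => j _; rewrite mxE mul0r.
(* At frequency 0 the sine is the zero function and the cosine is 1, so only the mean survives. *)
have S0 : wave 0 1 0 = wave 0 0 0 :> (_ -> R).
  by apply/funext => x; rewrite /wave dot0 sin0 !mul0r mulr0.
rewrite fourierE S0 [u i (wave 0 0 0)]linear_wave // !mul0r addr0 mulr0 subr0.
rewrite -[RHS](mu i) /mean; congr (_ * u i _).
by apply/funext => x; rewrite /wave dot0 cos0 mul1r mul0r addr0.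
Qed.

Lemma energy_le_curl u (s : R) xi :
  vector_field u -> mean_zero u -> divergence_free u ->
  bracket R xi `^ (2 * (s + 1)) * energy u xi <=
  2 * (bracket R xi `^ (2 * s) * energy (curl u) xi).
Proof.
move=> vu mu divu.
have [->|xi0] := eqVneq xi 0.
  rewrite [energy u 0]big1 ?mulr0 => [|i _].
    by rewrite !mulr_ge0 ?powR_ge0 ?energy_ge0.
  by rewrite fourier0_mean_zero // Normc.normc0 expr0n.
rewrite bracket_powRD1 energy_curl // -mulrA [leRHS]mulrCA ler_wpM2l ?powR_ge0 //.
rewrite mulrA ler_wpM2r ?energy_ge0 //.
(* What remains is $1+|\xi|^2 \le 2|\xi|^2$. *)
by have := sqr_freq_ge1 xi0; lra.
Qed.

End Bound.

Local Open Scope ereal_scope.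

Theorem proposition3p3 (R : realType) :
  exists C : R, forall u : 'I_3 -> functional R,
    vector_field u -> mean_zero u -> divergence_free u ->
    forall s : R, Hnorm s (curl u) < +oo ->
      Hnorm (s + 1)%R u <= C%:E * Hnorm s (curl u).
Proof.
exists (Num.sqrt 2) => u vu mu divu s _; rewrite /Hnorm.
set E := esum _ (fun xi : 'rV[int]_3 => (bracket R xi `^ (2 * s) * _)%:E).
have E0 : 0 <= E.
  by apply: esum_ge0 => xi _; rewrite lee_fin mulr_ge0 ?powR_ge0 ?energy_ge0.
have -> : (Num.sqrt 2)%:E * sqrte E = sqrte (2%:E * E).
  by rewrite sqrteM // lee_fin.
(* The squared norms are compared; writing [2 * E] as [E + E] brings the factor inside the sum,
   where the modewise bound applies. *)
rewrite lee_sqrt ?mule_ge0 ?lee_fin // mule_natl mule2n -esumD; last 2 first.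
- by move=> xi _; rewrite lee_fin mulr_ge0 ?powR_ge0 ?energy_ge0.
- by move=> xi _; rewrite lee_fin mulr_ge0 ?powR_ge0 ?energy_ge0.
apply: le_esum => xi _; rewrite -EFinD lee_fin.
by have := energy_le_curl s xi vu mu divu; rewrite [leRHS]mulr_natl [leRHS]mulr2n.
Qed.
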